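(* Let $f,g$ be non-degenerate real ternary quadratic forms generating a pencil in orbit III or IIIa. (1) If it is in orbit III, then $p_2<0$. (2) If it is in orbit IIIa, then $p_2>0$.
   Context: A pencil of conics is a projective line in $\mathbb{P}(S^2{\mathbb{R}^3}^* )$. Orbits of pencils are under $PGL(3,\mathbb{R})$: orbit III is the orbit of the pencil generated by $xz$ and $y^2$; orbit IIIa that of the pencil generated by $x^2+y^2$ and $z^2$. Let $\mathrm{Matrix}(q)$ be the symmetric matrix of a quadratic form $q$, and $\phi(t)=\det\mathrm{Matrix}(tf+g)=\Phi_{30}t^3+\Phi_{21}t^2+\Phi_{12}t+\Phi_{03}$. Define $\psi(t)$ by $\det(vI-\mathrm{Matrix}(tf+g))=v^3-\mu(t)v^2+\psi(t)v-\phi(t)$. Let $P=p_2t^2+p_1t+p_0$ be the remainder in the euclidean division of $\Phi_{30}\,\psi\,\phi'$ by $\phi$. *)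

(* Defs.v *)
From HB Require Import structures.
From mathcomp Require Import all_boot all_order all_algebra.
From mathcomp Require Import reals.
From mathcomp Require Import mpoly ring.

Set Implicit Arguments.
Unset Strict Implicit.
Unset Printing Implicit Defensive.

Import Order.TTheory GRing.Theory Num.Theory.
Local Open Scope ring_scope.

Notation qform R := (dhomog 3 R 2).

Section TernaryForms.
Variable R : realType.
Implicit Types (q f g : qform R) (A : 'M[R]_3).

Definition lin_subst A : 3.-tuple {mpoly R[3]} :=
  [tuple \sum_(j < 3) A i j *: 'X_j | i < 3].

Lemma comp_lin_subst_homog A q : val q \mPo lin_subst A \is 2.-homog.
Proof.
have homX (i : 'I_3) : ('X_i : {mpoly R[3]}) \is 1.-homog.
  by rewrite dhomogX; apply/eqP/mdeg1.
have homL (i : 'I_3) : tnth (lin_subst A) i \is 1.-homog.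
  rewrite tnth_mktuple; apply: rpred_sum => j _.
  exact/dhomogZ/homX.
rewrite comp_mpolyEX big_seq; apply: rpred_sum => m m_q; apply: dhomogZ.
have dm : mdeg m = 2 by apply: (dhomog_mf (dhomog_is_dhomog q)).
suff: \prod_(i < 3) tnth (lin_subst A) i ^+ m i \is (mdeg m).-homog.
  by rewrite dm comp_mpolyX.
rewrite mdegE.
elim/big_ind2: _ => [|d p e r hp hr|i _]; first exact: dhomog1.
- exact: dhomogM.
- by have := dhomogMn (m i) (homL i); rewrite mul1n.
Qed.

(* [qsubst A q] is the form v |-> q (A v). *)
Definition qsubst A q : qform R := DHomog (comp_lin_subst_homog A q).

Lemma qsubst_is_linear A : linear (qsubst A).
Proof. by move=> c p q; apply/val_inj; rewrite /= linearP. Qed.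

HB.instance Definition _ A :=
  GRing.isLinear.Build R (qform R) (qform R) _ (qsubst A) (qsubst_is_linear A).

(* A projective line in P(S^2 (R^3)^* ), seen as the 2-dimensional space of
   forms above it. *)
Definition is_pencil (L : {vspace qform R}) : bool := \dim L == 2.

Definition pencil_span f g : {vspace qform R} := <<[:: f; g]>>%VS.

(* Scalar matrices fix every subspace of forms, so the PGL(3, R)-orbits of
   pencils are the GL(3, R)-orbits. *)
Definition same_PGL_orbit (L L' : {vspace qform R}) : Prop :=
  exists2 A, A \in unitmx & L' = (linfun (qsubst A) @: L)%VS.

Local Notation x := ('X_(0 : 'I_3) : {mpoly R[3]}).
Local Notation y := ('X_(1 : 'I_3) : {mpoly R[3]}).
Local Notation z := ('X_(2 : 'I_3) : {mpoly R[3]}).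

Lemma xz_homog : x * z \is 2.-homog.
Proof. by apply: (@dhomogM _ _ _ 1 _ 1); rewrite dhomogX /= mdeg1. Qed.

Lemma y2_homog : y ^+ 2 \is 2.-homog.
Proof. by apply: (@dhomogMn _ _ _ 1); rewrite dhomogX /= mdeg1. Qed.

Lemma x2y2_homog : x ^+ 2 + y ^+ 2 \is 2.-homog.
Proof.
by apply: dhomogD; apply: (@dhomogMn _ _ _ 1); rewrite dhomogX /= mdeg1.
Qed.

Lemma z2_homog : z ^+ 2 \is 2.-homog.
Proof. by apply: (@dhomogMn _ _ _ 1); rewrite dhomogX /= mdeg1. Qed.

Definition in_orbit_III (L : {vspace qform R}) : Prop :=
  same_PGL_orbit (pencil_span (DHomog xz_homog) (DHomog y2_homog)) L.

Definition in_orbit_IIIa (L : {vspace qform R}) : Prop :=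
  same_PGL_orbit (pencil_span (DHomog x2y2_homog) (DHomog z2_homog)) L.

(* The off-diagonal entries are half the coefficients of the mixed monomials,
   so that q v = v^T (Matrix q) v, see [qmx_eval]. *)
Definition qmx q : 'M[R]_3 :=
  \matrix_(i, j) ((val q)@_(U_(i) + U_(j)) / (if i == j then 1 else 2)).

Definition nondegenerate_form q : bool := \det (qmx q) != 0.

(* Matrix(t f + g), with 'X in the role of the parameter t. *)
Definition pencil_mx f g : 'M[{poly R}]_3 :=
  'X *: map_mx polyC (qmx f) + map_mx polyC (qmx g).

Definition phi f g : {poly R} := \det (pencil_mx f g).

Definition mu f g : {poly R} := \tr (pencil_mx f g).

(* [char_poly] is det (v I - _), a polynomial in v with coefficients in R[t];
   [psi] is the coefficient of v, see [char_poly_pencil]. *)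
Definition psi f g : {poly R} := (char_poly (pencil_mx f g))`_1.

Definition remP f g : {poly R} :=
  (((phi f g)`_3)%:P * psi f g * (phi f g)^`()) %% phi f g.

Lemma qmx_sym q : (qmx q)^T = qmx q.
Proof. by apply/matrixP => i j; rewrite !mxE addmC eq_sym. Qed.

Lemma qmx_is_linear : linear qmx.
Proof.
by move=> c p q; apply/matrixP => i j; rewrite !mxE mcoeffD mcoeffZ mulrDl mulrA.
Qed.

HB.instance Definition _ :=
  GRing.isLinear.Build R (qform R) 'M[R]_3 _ qmx qmx_is_linear.

Lemma mnm1D_eq (i j a b : 'I_3) :
  ((U_(i) + U_(j))%MM == (U_(a) + U_(b))%MM) =
  (i == a) && (j == b) || (i == b) && (j == a).
Proof.
apply/eqP/idP => [/mnmP E|].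
  have := E a; have := E b; rewrite !mnmDE !mnm1E !eqxx.
  do 4![case: eqVneq => //= ?; subst].
by case/orP => /andP[/eqP-> /eqP->] //; rewrite addmC.
Qed.

Lemma mdeg2P (m : 'X_{1..3}) :
  mdeg m = 2 -> exists i, exists j, m = (U_(i) + U_(j))%MM.
Proof.
move=> dm; have [i mi] : exists i, m i != 0.
  apply/existsP; rewrite -negb_forall; apply: contra_eqN dm => /forallP m0.
  by rewrite mdegE big1 // => i _; apply/eqP.
have le : (U_(i) <= m)%MM by rewrite lep1mP.
have : mdeg (m - U_(i))%MM == 1.
  by rewrite -(eqn_add2r 1) -[X in (_ + X == _)%N](mdeg1 i) -mdegD submK ?dm.
rewrite mdeg_eq1 => /existsP[j /eqP E]; exists i, j.
by rewrite -E addmC submK.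
Qed.

Lemma qform_sum q :
  val q = \sum_(i < 3) \sum_(j < 3) qmx q i j *: ('X_i * 'X_j).
Proof.
apply/mpolyP => m; rewrite raddf_sum /=.
under eq_bigr do rewrite raddf_sum /=.
under eq_bigr do under eq_bigr do rewrite mcoeffZ -mpolyXD mcoeffX.
have [dm|dm] := eqVneq (mdeg m) 2; last first.
  rewrite (dhomog_nemf_coeff (dhomog_is_dhomog q) dm) big1 // => i _.
  rewrite big1 // => j _; case: eqVneq => [E|]; last by rewrite mulr0.
  by rewrite -E mdegD !mdeg1 eqxx in dm.
have [a [b ->]] := mdeg2P dm.
under eq_bigr do under eq_bigr do rewrite mnm1D_eq.
have Qs i j : qmx q i j = qmx q j i by rewrite !mxE addmC eq_sym.
have -> : (val q)@_(U_(a) + U_(b)) = qmx q a b * (if a == b then 1 else 2).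
  by rewrite mxE; case: ifP => _; rewrite ?divr1 ?mulr1 ?divfK ?pnatr_eq0.
rewrite (bigD1 a) //= (bigD1 b) //= !eqxx /= mulr1.
case: (eqVneq a b) => [<-|nab].
  rewrite mulr1 big1 ?addr0 => [|i /negPf ni]; last by rewrite ni !andbF mulr0.
  rewrite big1 ?addr0 // => i /negPf ni; rewrite big1 // => j _.
  by rewrite ni mulr0.
rewrite big1 ?addr0 => [|i /negPf ni]; last first.
  by rewrite ni /= mulr0.
rewrite (bigD1 b) 1?eq_sym //= (bigD1 a) //= !eqxx orbT mulr1 Qs.
rewrite big1 ?addr0 => [|i /negPf ni]; last first.
  by rewrite ni andbF orbF (negPf nab) mulr0.
rewrite big1 ?addr0 => [|i /andP[/negPf na /negPf nb]]; last first.
  by rewrite big1 // => j _; rewrite na nb mulr0.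
by rewrite mulr_natr mulr2n.
Qed.

Lemma qmx_eval q (v : 'cV[R]_3) :
  (v^T *m qmx q *m v) 0 0 = (val q).@[fun i => v i 0].
Proof.
rewrite [in RHS]qform_sum raddf_sum mxE /=.
under [RHS]eq_bigr do rewrite raddf_sum /=.
rewrite [RHS]exchange_big /=.
apply: eq_bigr => j _; rewrite mxE mulr_suml; apply: eq_bigr => i _.
by rewrite mevalZ mevalM !mevalXU mxE mulrCA mulrA.
Qed.

Lemma pencil_mx_horner f g t :
  map_mx (horner_eval t) (pencil_mx f g) = qmx (t *: f + g).
Proof.
rewrite linearP; apply/matrixP => i j.
by rewrite !mxE /horner_eval !hornerE.
Qed.

Lemma phi_horner f g t : (phi f g).[t] = \det (qmx (t *: f + g)).
Proof. by rewrite -pencil_mx_horner det_map_mx. Qed.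

Lemma char_poly_pencil f g :
  char_poly (pencil_mx f g) =
    'X^3 - (mu f g)%:P * 'X^2 + (psi f g)%:P * 'X - (phi f g)%:P.
Proof.
have sz := size_char_poly (pencil_mx f g).
have mon := monicP (char_poly_monic (pencil_mx f g)).
rewrite lead_coefE sz /= in mon.
have c2 := char_poly_trace (pencil_mx f g) isT.
have c0 := char_poly_det (pencil_mx f g).
rewrite /psi /mu /phi.
move: (char_poly _) sz mon c2 c0 => c sz mon /= c2 c0.
apply/polyP => -[|[|[|[|i]]]]; rewrite ![in RHS](coefE, coefXn) /=.
- by rewrite c0; ring.
- by ring.
- by rewrite c2; ring.
- by rewrite mon; ring.
- by rewrite nth_default ?sz //; ring.
Qed.

End TernaryForms.

(* Main.v *)
Require Import Defs.
From mathcomp Require Import all_boot all_order all_algebra.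
From mathcomp Require Import reals.
From mathcomp Require Import mpoly ring lra.

(** Any two generators of the pencil are f = (a q1 + b q2) o A and
    g = (c q1 + d q2) o A, with q1, q2 the generators of the model pencil, A an
    invertible substitution and a d - b c != 0.  In both orbits q2 is the
    square of a linear form, which makes the pair (q1, q2) degenerate in the
    same way.  Writing L = a t + c, M = b t + d and D1, D2 for the matrices of
    q1, q2, the matrix of t f + g is A^T (L D1 + M D2) A, and
    - phi = k L^2 M for some constant k, and k, a, b are nonzero because f is
      nondegenerate;
    - psi, the sum of the principal 2-minors, is quadratic in (L, M):
      psi = e L^2 + h L M, where e is the sum of the principal 2-minors of
      A^T D1 A; there is no M^2 term because A^T D2 A has rank 1.
    As L divides both psi and phi', L^2 divides Phi30 psi phi' as well as phi,
    so that the remainder is a constant multiple of L^2, and its value at the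
    root of M fixes the constant.  The result is
    p2 = e (k a^2 (a d - b c))^2 ([coef2_modp_split_cubic]), hence p2 has the
    sign of e ([pencil_coef2_sign]).

    That sign is read off from the degenerate conic q1 o A.  If u, v are the
    rows of A entering q1, then e = |u x v|^2 when q1 = x^2 + y^2 and
    e = - |u x v|^2 / 4 when q1 = x z.  The coordinates of u x v are, up to
    signs, the cofactors of A along the remaining row, and they cannot all
    vanish because A is invertible. *)

Set Implicit Arguments.
Unset Strict Implicit.
Unset Printing Implicit Defensive.

Import Order.TTheory GRing.Theory Num.Theory.
Local Open Scope ring_scope.

(** * Determinants and principal minors of 3 x 3 matrices *)

Lemma sum3E (V : nmodType) (F : 'I_3 -> V) :
  \sum_(i < 3) F i = F 0 + F 1 + F 2.
Proof.
rewrite !big_ord_recr big_ord0 /= add0r.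
by congr (F _ + F _ + F _); apply/val_inj.
Qed.

(** Indexing by naturals lets the ordinals produced by Laplace expansion, such
    as [lift 0 1], reduce to numerals that [ring] can identify. *)
Definition nat_entry (S : Type) (M : 'M[S]_3) (i j : nat) : S :=
  M (inord i) (inord j).

Lemma nat_entryE (S : Type) (M : 'M[S]_3) (i j : 'I_3) :
  M i j = nat_entry M i j.
Proof. by rewrite /nat_entry !inord_val. Qed.

Lemma cofactor3E (S : comNzRingType) (M : 'M[S]_3) (i j : 'I_3) :
  cofactor M i j = (-1) ^+ (i + j) *
    (nat_entry M (bump i 0) (bump j 0) * nat_entry M (bump i 1) (bump j 1)
     - nat_entry M (bump i 0) (bump j 1) * nat_entry M (bump i 1) (bump j 0)).
Proof.
rewrite /cofactor (expand_det_row _ 0) !big_ord_recr big_ord0 /= /cofactor.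
by rewrite !det_mx11 !mxE !nat_entryE /=; ring.
Qed.

Lemma det3E (S : comNzRingType) (M : 'M[S]_3) :
  \det M = M 0 0 * (M 1 1 * M 2 2 - M 1 2 * M 2 1)
         - M 0 1 * (M 1 0 * M 2 2 - M 1 2 * M 2 0)
         + M 0 2 * (M 1 0 * M 2 1 - M 1 1 * M 2 0).
Proof.
rewrite (expand_det_row _ 0) sum3E !cofactor3E !nat_entryE /bump /=; ring.
Qed.

Definition principal_minors2 (S : comNzRingType) (M : 'M[S]_3) : S :=
  (M 0 0 * M 1 1 - M 0 1 * M 1 0) + (M 0 0 * M 2 2 - M 0 2 * M 2 0)
  + (M 1 1 * M 2 2 - M 1 2 * M 2 1).

Lemma char_poly3_coef1 (S : comNzRingType) (M : 'M[S]_3) :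
  (char_poly M)`_1 = principal_minors2 M.
Proof.
(* Exhibiting the polynomial by its coefficients leaves one ring identity. *)
rewrite /char_poly det3E !mxE /= !mulr1n !mulr0n.
set c0 := M 0 0 * (M 1 1 * M 2 2 - M 1 2 * M 2 1)
         - M 0 1 * (M 1 0 * M 2 2 - M 1 2 * M 2 0)
         + M 0 2 * (M 1 0 * M 2 1 - M 1 1 * M 2 0).
set c2 := M 0 0 + M 1 1 + M 2 2.
transitivity (('X^3 - c2%:P * 'X^2 + (principal_minors2 M)%:P * 'X - c0%:P)`_1).
  by congr (polyseq _)`_1; rewrite /c2 /c0 /principal_minors2; ring.
by rewrite !(coefE, coefXn) /=; ring.
Qed.

(** The mixed coefficient [h] drops out of the remainder computed below, so it
    is left existential. *)
Lemma principal_minors2_pencil (S : comNzRingType) (P Q : 'M[S]_3) : exists h,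
  forall L M : {poly S},
  principal_minors2 (L *: map_mx polyC P + M *: map_mx polyC Q) =
    (principal_minors2 P)%:P * L ^+ 2 + h%:P * L * M
    + (principal_minors2 Q)%:P * M ^+ 2.
Proof.
(* Polarization of a quadratic form. *)
exists (principal_minors2 (P + Q) - principal_minors2 P - principal_minors2 Q).
move=> L M.
rewrite /principal_minors2 !mxE; ring.
Qed.

(** If all cofactors along a row vanished, so would the determinant. *)
Lemma sum_sqr_cofactor_gt0 (R : realFieldType) (n : nat) (A : 'M[R]_n)
    (i : 'I_n) :
  A \in unitmx -> 0 < \sum_j cofactor A i j ^+ 2.
Proof.
rewrite unitmxE unitfE => detA.
rewrite lt_neqAle eq_sym sumr_ge0 ?andbT; last first.
  by move=> j _; rewrite sqr_ge0.
apply: contra_neq detA => /eqP.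
rewrite psumr_eq0 => [/allP cof0|j _]; last exact: sqr_ge0.
rewrite (expand_det_row _ i) big1 // => j _.
by have := cof0 j (mem_index_enum _); rewrite sqrf_eq0 => /eqP->; rewrite mulr0.
Qed.

(** * The matrix of a form under substitution *)

Section Forms.
Variable R : realType.
Implicit Types (f g q : qform R) (A D : 'M[R]_3).

(** Polarization, which divides by 2; it lets the matrix of a form be recognized
    from the values of the form. *)
Lemma sym_mx_polar (S T : 'M[R]_3) : S^T = S -> T^T = T ->
  (forall v : 'cV[R]_3, (v^T *m S *m v) 0 0 = (v^T *m T *m v) 0 0) -> S = T.
Proof.
move=> Ss Ts ST.
have bil (B : 'M[R]_3) i j :
    ((delta_mx i 0 : 'cV_3)^T *m B *m (delta_mx j 0 : 'cV_3)) 0 0 = B i j.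
  by rewrite trmx_delta -rowE -colE !mxE.
have addE (X Y : 'M[R]_1) : (X + Y) 0 0 = X 0 0 + Y 0 0 by rewrite mxE.
have diag i : S i i = T i i by have := ST (delta_mx i 0); rewrite !bil.
apply/matrixP => i j.
(* The value at e_i + e_j isolates twice the entry (i, j). *)
have := ST (delta_mx i 0 + delta_mx j 0).
rewrite !linearD /= !mulmxDl !addE !bil !diag.
have -> : S j i = S i j by rewrite -[in LHS]Ss mxE.
have -> : T j i = T i j by rewrite -[in LHS]Ts mxE.
by move=> E; lra.
Qed.

Lemma qmx_qsubst A q : qmx (qsubst A q) = A^T *m qmx q *m A.
Proof.
apply: sym_mx_polar; rewrite ?qmx_sym ?trmx_mul ?trmxK ?qmx_sym ?mulmxA //.
move=> v; rewrite qmx_eval /= comp_mpoly_meval.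
have -> : v^T *m (A^T *m qmx q *m A) *m v = (A *m v)^T *m qmx q *m (A *m v).
  by rewrite trmx_mul !mulmxA.
rewrite qmx_eval; apply: meval_eq => i.
rewrite tnth_mktuple raddf_sum mxE; apply: eq_bigr => j _ /=.
by rewrite mevalZ mevalXU.
Qed.

Lemma qmx_mul_vars q (a b : 'I_3) : val q = 'X_a * 'X_b ->
  qmx q = 2^-1 *: (delta_mx a b + delta_mx b a).
Proof.
move=> qE; apply/matrixP => i j; rewrite !mxE qE -mpolyXD mcoeffX mnm1D_eq.
rewrite ![_ == i]eq_sym ![_ == j]eq_sym.
have [<-|nij] := eqVneq i j.
  by rewrite [(i == b) && _]andbC orbb; field.
have /negbTE excl : ~~ [&& (i == a) && (j == b), i == b & j == a].
  by apply: contraNN nij => /and3P[/andP[/eqP-> _] _ /eqP->].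
rewrite [(j == a) && _]andbC; move: excl.
by case: ((i == a) && (j == b)); case: ((i == b) && (j == a)) => //= _; field.
Qed.

(** * Principal minors of the model conics after substitution *)

Lemma principal_minors2_rank1 A (k : 'I_3) :
  principal_minors2 (A^T *m delta_mx k k *m A) = 0.
Proof.
(* The matrix is the outer product of row k of A with itself. *)
have E i j : (A^T *m delta_mx k k *m A) i j = A k i * A k j.
  rewrite -(mul_delta_mx (0 : 'I_1)) mulmxA -mulmxA -colE -rowE !mxE big_ord1.
  by rewrite !mxE.
by rewrite /principal_minors2 !E; ring.
Qed.

(** Lagrange's identity |u|^2 |v|^2 - (u.v)^2 = |u x v|^2 for rows 0 and 1 of
    [A], whose cross product consists of the cofactors along row 2. *)
Lemma principal_minors2_sum_squares A :
  principal_minors2 (A^T *m (delta_mx 0 0 + delta_mx 1 1) *m A) =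
  \sum_j cofactor A 2 j ^+ 2.
Proof.
rewrite /principal_minors2 sum3E !cofactor3E /bump /=.
rewrite !(mxE, sum3E) /= !nat_entryE /=; ring.
Qed.

(** Again Lagrange's identity, for rows 0 and 2: the sign is negative because a
    product of two independent linear forms has one positive and one negative
    eigenvalue, whose product is this sum of minors. *)
Lemma principal_minors2_product A :
  principal_minors2 (A^T *m (2^-1 *: (delta_mx 0 2 + delta_mx 2 0)) *m A) =
  - 4^-1 * \sum_j cofactor A 1 j ^+ 2.
Proof.
rewrite /principal_minors2 sum3E !cofactor3E /bump /=.
rewrite !(mxE, sum3E) /= !nat_entryE /=.
by field.
Qed.

(** * The remainder *)

(** The dividend is F`_3 * k L^2 (e L + h M) (2 a M + b L), so only
    (e L + h M) (2 a M + b L) has to be reduced modulo M.  The term in h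
    vanishes there and L takes the value (b c - a d) / b at the root of M, which
    leaves e b ((b c - a d) / b)^2. *)
Lemma coef2_modp_split_cubic (k a b c d e h : R) :
  k != 0 -> a != 0 -> b != 0 ->
  let L := a *: 'X + c%:P in let M := b *: 'X + d%:P in
  let F := k%:P * L ^+ 2 * M in
  (((F`_3)%:P * (e%:P * L ^+ 2 + h%:P * L * M) * F^`()) %% F)`_2 =
  e * (k * a ^+ 2 * (a * d - b * c)) ^+ 2.
Proof.
move=> k0 a0 b0 L M F.
have FE : F = Poly [:: k * c ^+ 2 * d; k * (2 * a * c * d + c ^+ 2 * b);
                 k * (a ^+ 2 * d + 2 * a * b * c); k * a ^+ 2 * b].
  by rewrite /F /L /M /= !cons_poly_def -!mul_polyC polyC0; ring.
have lead_nz : k * a ^+ 2 * b != 0 by rewrite !mulf_neq0 ?expf_neq0.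
have -> : F`_3 = k * a ^+ 2 * b by rewrite FE coef_Poly.
have -> : F^`() = k%:P * L * (2 * a%:P * M + b%:P * L).
  by rewrite /F /L /M !derivE -!mul_polyC; ring.
(* With a = t b every identity below is polynomial, and L = t M + w. *)
have [t at_b] : exists t, a = t * b by exists (a / b); rewrite divfK.
pose w := c - t * d.
pose s := (k * a ^+ 2 * b)%:P *
  (2 * (a * e)%:P * L + h%:P * (2 * a%:P * M + b%:P * L)
   + (e * a)%:P * (L + w%:P)).
(* A constant multiple of L^2, given by coefficients to bound its size. *)
pose r := Poly [seq k * a ^+ 2 * b * e * b * k * w ^+ 2 * l
               | l <- [:: c ^+ 2; 2 * a * c; a ^+ 2]].
have <- : r = ((k * a ^+ 2 * b)%:P * (e%:P * L ^+ 2 + h%:P * L * M)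
             * (k%:P * L * (2 * a%:P * M + b%:P * L))) %% F.
  apply: (@modpP _ _ s).
    rewrite /r /s /F /L /M /w /= !cons_poly_def -!mul_polyC polyC0 at_b; ring.
  have -> : size F = 4%N by rewrite FE (@PolyK _ 0).
  exact: (leq_ltn_trans (size_Poly _)).
by rewrite /r coef_Poly /= /w at_b; ring.
Qed.

(** The factor [r] is (k (det A)^2 a^2 (a d - b c))^2.  It is nonzero because
    [f] is nondegenerate: det (qmx f) = k (det A)^2 a^2 b. *)
Lemma remP_coef2_sign A D1 D2 k f g (a b c d : R) :
    nondegenerate_form f -> a * d - b * c != 0 ->
    (forall L M : {poly R},
      \det (L *: map_mx polyC D1 + M *: map_mx polyC D2) = k%:P * L ^+ 2 * M) ->
    principal_minors2 (A^T *m D2 *m A) = 0 ->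
    qmx f = A^T *m (a *: D1 + b *: D2) *m A ->
    qmx g = A^T *m (c *: D1 + d *: D2) *m A ->
  exists2 r, 0 < r & (remP f g)`_2 = principal_minors2 (A^T *m D1 *m A) * r.
Proof.
move=> f_nd ad_bc detD D2_0 fE gE.
pose L := a *: 'X + c%:P : {poly R}; pose M := b *: 'X + d%:P : {poly R}.
pose DLM := L *: map_mx polyC D1 + M *: map_mx polyC D2.
pose AP := map_mx polyC A.
have pencilE : pencil_mx f g = AP^T *m DLM *m AP.
  rewrite /pencil_mx fE gE !map_mxM !map_mxD !map_mxZ map_trmx -/AP.
  rewrite scalemxAl scalemxAr -mulmxDl -mulmxDr; congr (_ *m _ *m _).
  by apply/matrixP => i j; rewrite /DLM /L /M !mxE -!mul_polyC; ring.
pose k' := k * \det A ^+ 2.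
have phiE : phi f g = k'%:P * L ^+ 2 * M.
  rewrite /phi pencilE !det_mulmx det_tr detD /AP det_map_mx /k'; ring.
have [h hE] := principal_minors2_pencil (A^T *m D1 *m A) (A^T *m D2 *m A).
have psiE :
    psi f g = (principal_minors2 (A^T *m D1 *m A))%:P * L ^+ 2 + h%:P * L * M.
  rewrite /psi char_poly3_coef1 -[RHS]addr0 -[0](mul0r (M ^+ 2)) -polyC0.
  rewrite -D2_0 -hE pencilE.
  congr principal_minors2; rewrite !map_mxM map_trmx -/AP mulmxDr mulmxDl.
  by rewrite -!scalemxAr -!scalemxAl.
have : k' * a ^+ 2 * b != 0.
  move: f_nd; rewrite /nondegenerate_form fE !det_mulmx det_tr.
  have -> : \det (a *: D1 + b *: D2) = k * a ^+ 2 * b.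
    apply: polyC_inj; rewrite -det_map_mx map_mxD !map_mxZ detD; ring.
  by apply: contraNneq => E; rewrite /k' in E; apply/eqP; ring: E.
rewrite mulf_eq0 mulf_eq0 !negb_or expf_eq0 /= => /andP[/andP[k0 a0] b0].
exists ((k' * a ^+ 2 * (a * d - b * c)) ^+ 2).
  by rewrite exprn_even_gt0 //= (mulf_neq0 _ ad_bc) // mulf_neq0 ?expf_neq0.
by rewrite /remP psiE phiE coef2_modp_split_cubic.
Qed.

(** * The two orbits *)

(** If a d - b c vanished, then d f = b g and c f = a g would be linear
    relations between [f] and [g]. *)
Lemma pencil_coords A q1 q2 f g :
  is_pencil (pencil_span f g) ->
  pencil_span f g = (linfun (qsubst A) @: pencil_span q1 q2)%VS ->
  exists a b c d, [/\ a * d - b * c != 0,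
    qmx f = A^T *m (a *: qmx q1 + b *: qmx q2) *m A &
    qmx g = A^T *m (c *: qmx q1 + d *: qmx q2) *m A].
Proof.
move=> fg_pencil; rewrite /pencil_span limg_span /= => spanE.
have coords q : q \in <<[:: f; g]>>%VS -> exists s t,
    q = s *: qsubst A q1 + t *: qsubst A q2 /\
    qmx q = A^T *m (s *: qmx q1 + t *: qmx q2) *m A.
  rewrite spanE span_cons span_seq1.
  move=> /memv_addP[_ /vlineP[s ->] [_ /vlineP[t ->] ->]].
  exists s, t; rewrite !lfunE; split=> //.
  rewrite linearD !linearZ /= !qmx_qsubst mulmxDr mulmxDl.
  by rewrite -!scalemxAr -!scalemxAl.
have [|a [b [fE f_mx]]] := coords f; first by rewrite memv_span ?inE ?eqxx.
have [|c [d [gE g_mx]]] := coords g.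
  by rewrite memv_span ?inE ?eqxx ?orbT.
exists a, b, c, d; split=> //.
have : free [:: f; g] by [].
rewrite free_cons seq1_free span_seq1 => /andP[f_g g0].
have indep s t : s *: f = t *: g -> s = 0.
  move=> E; apply: contraNeq f_g => s0; apply/vlineP; exists (s^-1 * t).
  by rewrite -scalerA -E scalerA mulVf ?scale1r.
apply: contraNneq g0 => /eqP; rewrite subr_eq0 => /eqP ad_bc.
have d0 : d = 0.
  apply: (indep _ b); rewrite fE gE !scalerDr !scalerA.
  by congr (_ *: _ + _ *: _); ring: ad_bc.
have c0 : c = 0.
  apply: (indep _ a); rewrite fE gE !scalerDr !scalerA.
  by congr (_ *: _ + _ *: _); ring: ad_bc.
by rewrite gE c0 d0 !scale0r addr0.
Qed.

Lemma pencil_coef2_sign q1 q2 k f g A :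
    nondegenerate_form f -> is_pencil (pencil_span f g) ->
    (forall L M : {poly R},
      \det (L *: map_mx polyC (qmx q1) + M *: map_mx polyC (qmx q2)) =
      k%:P * L ^+ 2 * M) ->
    principal_minors2 (A^T *m qmx q2 *m A) = 0 ->
    pencil_span f g = (linfun (qsubst A) @: pencil_span q1 q2)%VS ->
  exists2 r, 0 < r & (remP f g)`_2 = principal_minors2 (A^T *m qmx q1 *m A) * r.
Proof.
move=> f_nd fg_pencil detq q2_0 spanE.
have [a [b [c [d [ad_bc fE gE]]]]] := pencil_coords fg_pencil spanE.
exact: remP_coef2_sign f_nd ad_bc detq q2_0 fE gE.
Qed.

End Forms.

Theorem proposition6 (R : realType) (f g : qform R)
    (f_nd : nondegenerate_form f) (g_nd : nondegenerate_form g)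
    (fg_pencil : is_pencil (pencil_span f g)) :
  (in_orbit_III (pencil_span f g) -> (remP f g)`_2 < 0) /\
  (in_orbit_IIIa (pencil_span f g) -> 0 < (remP f g)`_2).
Proof.
have sqr_mx (i : 'I_3) :
    2^-1 *: (delta_mx i i + delta_mx i i) = delta_mx i i :> 'M[R]_3.
  by apply/matrixP => ? ?; rewrite !mxE; field.
split=> -[A A_unit spanE].
- have xzE := qmx_mul_vars (q := DHomog (xz_homog R)) erefl.
  have y2E : qmx (DHomog (y2_homog R)) = delta_mx 1 1.
    by rewrite (@qmx_mul_vars _ _ 1 1) ?sqr_mx.
  have [||r r0 ->] := pencil_coef2_sign (k := - 4^-1) f_nd fg_pencil _ _ spanE.
  - (* Over {poly R}, [ring] takes 4^-1 and 2^-1 for unrelated constants. *)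
    move=> L M; have -> : 4^-1 = 2^-1 ^+ 2 :> R by field.
    by rewrite xzE y2E det3E !mxE /=; ring.
  - by rewrite y2E principal_minors2_rank1.
  rewrite pmulr_llt0 // xzE principal_minors2_product mulNr oppr_lt0.
  rewrite mulr_gt0 ?invr_gt0 //.
  exact: sum_sqr_cofactor_gt0.
- have z2E : qmx (DHomog (z2_homog R)) = delta_mx 2 2.
    by rewrite (@qmx_mul_vars _ _ 2 2) ?sqr_mx.
  have x2y2E : qmx (DHomog (x2y2_homog R)) = delta_mx 0 0 + delta_mx 1 1.
    have x2_homog : ('X_0 : {mpoly R[3]}) ^+ 2 \is 2.-homog.
      by apply: (@dhomogMn _ _ _ 1); rewrite dhomogX /= mdeg1.
    have -> : DHomog (x2y2_homog R) = DHomog x2_homog + DHomog (y2_homog R).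
      exact/val_inj.
    rewrite linearD /= (@qmx_mul_vars _ _ 0 0) // (@qmx_mul_vars _ _ 1 1) //.
    by rewrite !sqr_mx.
  have [||r r0 ->] := pencil_coef2_sign (k := 1) f_nd fg_pencil _ _ spanE.
  - by move=> L M; rewrite x2y2E z2E det3E !mxE /=; ring.
  - by rewrite z2E principal_minors2_rank1.
  rewrite pmulr_lgt0 // x2y2E principal_minors2_sum_squares.
  exact: sum_sqr_cofactor_gt0.
Qed.
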